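(* Let $n\ge 3$ and let $F_n^2$ be the complex $n$-dimensional Leibniz algebra with basis $\{x_1,\dots,x_n\}$ and multiplication $[x_i,x_1]=x_{i+1}$ for $1\le i\le n-2$ (all other products of basis elements are zero). The following cochains (bilinear maps $F_n^2\times F_n^2\to F_n^2$, with all values on pairs of basis elements not listed equal to zero) form a basis of the space $ZL^2(F_n^2,F_n^2)$: - $\varphi_{j,1}$ for $1\le j\le n-2$: $\varphi_{j,1}(x_j,x_1)=x_1$ and $\varphi_{j,1}(x_i,x_{j+1})=-x_{i+1}$ for $1\le i\le n-2$; - $\varphi_{j,k}$ for $1\le j\le n$, $2\le k\le n$: $\varphi_{j,k}(x_j,x_1)=x_k$; - $\psi_1$: $\psi_1(x_n,x_1)=x_1$ and $\psi_1(x_i,x_n)=-i\,x_i$ for $1\le i\le n-1$; - $\psi_j$ for $2\le j\le n-1$: $\psi_j(x_i,x_n)=x_{j+i-1}$ for $1\le i\le n-j$; - $\psi_n$: $\psi_n(x_1,x_n)=x_n$; - $\psi_{n+1}$: $\psi_{n+1}(x_n,x_n)=x_{n-1}$; - $\psi_{n+2}$: $\psi_{n+2}(x_n,x_n)=x_n$.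
   Context: A Leibniz algebra over $\mathbb{C}$ is a vector space $L$ with a bilinear bracket satisfying $[x,[y,z]]=[[x,y],z]-[[x,z],y]$ for all $x,y,z$. $ZL^2(L,L)$ denotes the space of $2$-cocycles (infinitesimal deformations): bilinear maps $\varphi:L\times L\to L$ with $$[x,\varphi(y,z)]-[\varphi(x,y),z]+[\varphi(x,z),y]+\varphi(x,[y,z])-\varphi([x,y],z)+\varphi([x,z],y)=0$$ for all $x,y,z\in L$. *)

(* Defs.v *)
From HB Require Import structures.
From mathcomp Require Import all_boot all_order all_algebra.
From mathcomp Require Import reals complex.

Set Implicit Arguments.
Unset Strict Implicit.
Unset Printing Implicit Defensive.

Import GRing.Theory.
Local Open Scope ring_scope.

(* 2-cochains are bilinear maps L x L -> L in curried form, so that they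
   inherit a finite-dimensional vector space structure. *)
Notation cochain2 L := 'Hom(L, 'Hom(L, L)) (only parsing).

Section Leibniz.
Variables (K : fieldType) (L : vectType K).

Definition leibniz_identity (br : cochain2 L) : Prop :=
  forall x y z : L, br x (br y z) = br (br x y) z - br (br x z) y.

Record leibniz_bracket := LeibnizBracket {
  lbracket :> cochain2 L;
  _ : leibniz_identity lbracket }.

Variable br : leibniz_bracket.

Definition cocycle_expr (phi : cochain2 L) (x y z : L) : L :=
  br x (phi y z) - br (phi x y) z + br (phi x z) y
  + phi x (br y z) - phi (br x y) z + phi (br x z) y.

(* Each level below is linear in its argument, so linfun wraps exactly the
   function it is given (see differentialE). *)
Definition differential_xy (phi : cochain2 L) (x y : L) : 'Hom(L, L) :=
  linfun (cocycle_expr phi x y).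

Definition differential_x (phi : cochain2 L) (x : L) : 'Hom(L, 'Hom(L, L)) :=
  linfun (differential_xy phi x).

Definition differential (phi : cochain2 L) :
    'Hom(L, 'Hom(L, 'Hom(L, L))) :=
  linfun (differential_x phi).

Definition ZL2 : {vspace cochain2 L} := lker (linfun differential).

Let combine6 (a : K) (p1 p2 p3 p4 p5 p6 q1 q2 q3 q4 q5 q6 : L) :
  (a *: p1 + q1) - (a *: p2 + q2) + (a *: p3 + q3) + (a *: p4 + q4)
    - (a *: p5 + q5) + (a *: p6 + q6)
  = a *: (p1 - p2 + p3 + p4 - p5 + p6) + (q1 - q2 + q3 + q4 - q5 + q6).
Proof.
rewrite !scalerDr !scalerN !opprD.
by rewrite !(addrACA _ q1, addrACA _ (q1 - q2), addrACA _ (q1 - q2 + q3),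
  addrACA _ (q1 - q2 + q3 + q4), addrACA _ (q1 - q2 + q3 + q4 - q5)).
Qed.

Fact cocycle_expr_linear phi x y : linear (cocycle_expr phi x y).
Proof.
move=> a u v; rewrite -combine6 /cocycle_expr.
by rewrite !(linearP, add_lfunE, scale_lfunE).
Qed.
HB.instance Definition _ phi x y :=
  GRing.isLinear.Build K L L _ (cocycle_expr phi x y)
    (cocycle_expr_linear phi x y).

Fact differential_xy_linear phi x : linear (differential_xy phi x).
Proof.
move=> a u v; apply/lfunP=> z.
rewrite !(add_lfunE, scale_lfunE) /differential_xy !lfunE /=.
rewrite -combine6 /cocycle_expr.
by rewrite !(linearP, add_lfunE, scale_lfunE).
Qed.
HB.instance Definition _ phi x :=
  GRing.isLinear.Build K L 'Hom(L, L) _ (differential_xy phi x)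
    (differential_xy_linear phi x).

Fact differential_x_linear phi : linear (differential_x phi).
Proof.
move=> a u v; apply/lfunP=> y; apply/lfunP=> z.
rewrite !(add_lfunE, scale_lfunE) /differential_x !lfunE /=.
rewrite /differential_xy -combine6 /cocycle_expr.
by rewrite !(linearP, add_lfunE, scale_lfunE).
Qed.
HB.instance Definition _ phi :=
  GRing.isLinear.Build K L 'Hom(L, 'Hom(L, L)) _ (differential_x phi)
    (differential_x_linear phi).

Lemma differentialE phi x y z :
  differential phi x y z = cocycle_expr phi x y z.
Proof.
rewrite /differential lfunE /= /differential_x lfunE /=.
by rewrite /differential_xy lfunE. Qed.

Fact differential_linear : linear differential.
Proof.
move=> a u v; apply/lfunP=> x; apply/lfunP=> y; apply/lfunP=> z.
rewrite !(add_lfunE, scale_lfunE) !differentialE -combine6 /cocycle_expr.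
by rewrite !(linearP, add_lfunE, scale_lfunE).
Qed.
HB.instance Definition _ :=
  GRing.isLinear.Build K (cochain2 L) 'Hom(L, 'Hom(L, 'Hom(L, L))) _
    differential differential_linear.

Lemma ZL2P (phi : cochain2 L) :
  reflect (forall x y z : L,
             br x (phi y z) - br (phi x y) z + br (phi x z) y
             + phi x (br y z) - phi (br x y) z + phi (br x z) y = 0)
          (phi \in ZL2).
Proof.
rewrite memv_ker lfunE /=; apply: (iffP eqP) => [d0 x y z | d0].
  by rewrite -/(cocycle_expr phi x y z) -differentialE d0 !zero_lfunE.
apply/lfunP=> x; apply/lfunP=> y; apply/lfunP=> z.
by rewrite differentialE !zero_lfunE; apply: d0.
Qed.

End Leibniz.

Section FiliformF2.
Variables (K : fieldType) (n : nat).

(* Basis vectors are numbered from 1 to n; x_ i = 0 for i outside [1, n]. *)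
Definition x_ (i : nat) : 'rV[K]_n := \row_(k < n) (k.+1 == i)%:R.

Definition bilin_sum (f : nat -> nat -> 'rV[K]_n) (u v : 'rV[K]_n) :
    'rV[K]_n :=
  \sum_(i < n) \sum_(j < n) (u 0 i * v 0 j) *: f i.+1 j.+1.

Definition bilin_row (f : nat -> nat -> 'rV[K]_n) (u : 'rV[K]_n) :
    'Hom('rV[K]_n, 'rV[K]_n) :=
  linfun (bilin_sum f u).

(* The bilinear map sending (x_ i, x_ j) to f i j for 1 <= i, j <= n. *)
Definition bilin_of (f : nat -> nat -> 'rV[K]_n) : cochain2 'rV[K]_n :=
  linfun (bilin_row f).

Fact bilin_sum_linear f u : linear (bilin_sum f u).
Proof.
move=> a p q; rewrite /bilin_sum scaler_sumr -big_split.
apply: eq_bigr => i _ /=; rewrite scaler_sumr -big_split.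
by apply: eq_bigr => j _ /=; rewrite !mxE mulrDr scalerDl scalerA mulrCA.
Qed.
HB.instance Definition _ f u :=
  GRing.isLinear.Build K 'rV[K]_n 'rV[K]_n _ (bilin_sum f u)
    (bilin_sum_linear f u).

Fact bilin_row_linear f : linear (bilin_row f).
Proof.
move=> a p q; apply/lfunP=> w.
rewrite !(add_lfunE, scale_lfunE) /bilin_row !lfunE /=.
rewrite /bilin_sum scaler_sumr -big_split.
apply: eq_bigr => i _ /=; rewrite scaler_sumr -big_split.
by apply: eq_bigr => j _ /=; rewrite !mxE mulrDl scalerDl scalerA mulrA.
Qed.
HB.instance Definition _ f :=
  GRing.isLinear.Build K 'rV[K]_n 'Hom('rV[K]_n, 'rV[K]_n) _ (bilin_row f)
    (bilin_row_linear f).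

Lemma bilin_ofE f u v :
  bilin_of f u v = \sum_(i < n) \sum_(j < n) (u 0 i * v 0 j) *: f i.+1 j.+1.
Proof. by rewrite /bilin_of lfunE /= /bilin_row lfunE. Qed.

Lemma bilin_of_basis f i j : (1 <= i <= n)%N -> (1 <= j <= n)%N ->
  bilin_of f (x_ i) (x_ j) = f i j.
Proof.
case: i j => [|i] [|j] //= ilt jlt.
rewrite bilin_ofE (bigD1 (Ordinal ilt)) //= (bigD1 (Ordinal jlt)) //=.
rewrite !mxE !eqxx mulr1 scale1r !big1 ?addr0 // => [k | k]; last first.
  rewrite -val_eqE => /= nk; rewrite !mxE eqSS (negPf nk).
  by rewrite mulr0 scale0r.
rewrite -val_eqE => /= nk; apply: big1 => l _.
by rewrite !mxE eqSS (negPf nk) mul0r scale0r.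
Qed.

Definition F2_mul : cochain2 'rV[K]_n := bilin_of (fun i j =>
  if (1 <= i <= n - 2)%N && (j == 1)%N then x_ i.+1 else 0).

Definition cochain_phi1 (j : nat) : cochain2 'rV[K]_n := bilin_of (fun a b =>
  if (a == j)%N && (b == 1)%N then x_ 1%N
  else if (1 <= a <= n - 2)%N && (b == j.+1)%N then - x_ a.+1
  else 0).

Definition cochain_phi (j k : nat) : cochain2 'rV[K]_n := bilin_of (fun a b =>
  if (a == j)%N && (b == 1)%N then x_ k else 0).

Definition cochain_psi1 : cochain2 'rV[K]_n := bilin_of (fun a b =>
  if (a == n)%N && (b == 1)%N then x_ 1%N
  else if (1 <= a <= n - 1)%N && (b == n)%N then - (a%:R *: x_ a)
  else 0).

Definition cochain_psi (j : nat) : cochain2 'rV[K]_n := bilin_of (fun a b =>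
  if (1 <= a <= n - j)%N && (b == n)%N then x_ (j + a - 1)%N else 0).

Definition cochain_psin : cochain2 'rV[K]_n := bilin_of (fun a b =>
  if (a == 1)%N && (b == n)%N then x_ n else 0).

Definition cochain_psin1 : cochain2 'rV[K]_n := bilin_of (fun a b =>
  if (a == n)%N && (b == n)%N then x_ (n - 1)%N else 0).

Definition cochain_psin2 : cochain2 'rV[K]_n := bilin_of (fun a b =>
  if (a == n)%N && (b == n)%N then x_ n else 0).

Definition ZL2_family : seq (cochain2 'rV[K]_n) :=
  [seq cochain_phi1 j | j <- iota 1 (n - 2)%N]            (* 1 <= j <= n-2 *)
  ++ [seq cochain_phi j k | j <- iota 1 n, k <- iota 2 (n - 1)%N]
                                      (* 1 <= j <= n and 2 <= k <= n *)
  ++ [:: cochain_psi1]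
  ++ [seq cochain_psi j | j <- iota 2 (n - 2)%N]          (* 2 <= j <= n-1 *)
  ++ [:: cochain_psin; cochain_psin1; cochain_psin2].

End FiliformF2.

Fact F2_leibniz (K : fieldType) (n : nat) : leibniz_identity (F2_mul K n).
Proof.
case: n => [|m] x y z; first by apply/rowP; case.
pose r (u : 'rV[K]_m.+1) := \sum_(i < m.+1)
  u 0 i *: (if (i.+1 <= m.+1 - 2)%N then x_ K m.+1 i.+2 else 0).
have F2E u v : F2_mul K m.+1 u v = v 0 ord0 *: r u.
  rewrite bilin_ofE scaler_sumr; apply: eq_bigr => i _.
  rewrite (bigD1 ord0) //= big1 ?addr0 ?andbT.
    by rewrite scalerA mulrC.
  move=> j; rewrite -val_eqE /= => j0.
  by rewrite eqSS (negPf j0) andbF scaler0.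
have r0 u : r u 0 ord0 = 0.
  rewrite summxE big1 // => i _; rewrite mxE.
  by case: ifP => _; rewrite !mxE ?mulr0.
have rZ a u : r (a *: u) = a *: r u.
  by rewrite scaler_sumr; apply: eq_bigr => i _; rewrite mxE scalerA.
by rewrite !F2E !rZ mxE r0 mulr0 scale0r !scalerA mulrC subrr.
Qed.

Definition F2 (K : fieldType) (n : nat) : leibniz_bracket 'rV[K]_n :=
  LeibnizBracket (@F2_leibniz K n).

(* Main.v *)
Require Import Defs.
From HB Require Import structures.
From mathcomp Require Import all_boot all_order all_algebra.
From mathcomp Require Import reals complex zify.

Set Implicit Arguments.
Unset Strict Implicit.
Unset Printing Implicit Defensive.

Import GRing.Theory.
Local Open Scope ring_scope.

(** The algebra has the single nonzero right multiplication r = [-, x_1], the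
    nilpotent shift x_1 -> x_2 -> ... -> x_(n-1) -> 0 with r x_n = 0; in
    general [u, v] = coef 1 v *: r u. Write R_c for the column phi(-, x_c) of
    a cochain phi, and put a_b = coef 1 (R_1 x_b). Evaluated on basis vectors,
    the cocycle equation is equivalent to three conditions (ZL2_F2P):
      - coef 1 (R_c x_b) = 0 for b, c >= 2;
      - r R_c - R_c r = - coef 1 (R_c x_1) *: r for c >= 2;
      - R_(shift b), which is zero when shift b = 0, equals - a_b *: r for
        b = 1 and - (a_b + coef 1 (R_b x_1)) *: r for b >= 2.
    The third condition determines R_2, ..., R_(n-1) as the multiples
    - a_1 *: r, ..., - a_(n-2) *: r, and at the two ends of the chain it says
    a_(n-1) = 0 and coef 1 (R_n x_1) = - a_n. What is left is R_1, free but
    for a_(n-1) = 0, and R_n, which is a_n times the diagonal map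
    x_i -> - i x_i (i < n), whose commutator with r is r, plus a map that
    commutes with r and has no x_1 component; such a map is determined by its
    value at x_1 and by its value at x_n, a combination of x_(n-1) and x_n.

    Duality replaces an explicit decomposition of a given cocycle. Each cochain
    of the family has a pivot (a, b, k), namely the coefficient of x_k in
    phi(x_a, x_b), and on the family the pivot functionals form a dual basis
    (pivot_dual). A family of cocycles with dual functionals is a basis of the
    cocycle space as soon as these functionals separate cocycles
    (basis_of_dual), and the argument above shows that a cocycle whose pivots
    all vanish is zero (ZL2_F2_pivots_eq0). *)

(** * Bases from dual functionals *)

(** For v in U, the vector v - \sum_j g j v *: f j lies in U and is killed by
    every g i, hence vanishes: this gives the spanning half. *)
Lemma basis_of_dual (K : fieldType) (V : vectType K) (I : eqType)
    (s : seq I) (f : I -> V) (g : I -> {scalar V}) (U : {vspace V}) :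
  uniq s ->
  {in s, forall i, f i \in U} ->
  {in s &, forall i j, g i (f j) = (i == j)%:R} ->
  {in U, forall v, {in s, forall i, g i v = 0} -> v = 0} ->
  basis_of U [seq f i | i <- s].
Proof.
move=> s_uniq fU dual sep.
have dual_sum (k : I -> K) i :
    i \in s -> g i (\sum_(j <- s) k j *: f j) = k i.
  move=> si; rewrite linear_sum (bigD1_seq i) //= linearZ /= dual // eqxx mulr1.
  rewrite big_seq_cond big1 ?addr0 // => j /andP[sj ji].
  by rewrite linearZ /= dual // eq_sym (negPf ji) mulr0.
rewrite /basis_of eqEsubv -andbA; apply/and3P; split.
- by apply/span_subvP=> _ /mapP[i si ->]; apply: fU.
- apply/subvP=> v Uv.
  have -> : v = \sum_(j <- s) g j v *: f j.
    apply/eqP; rewrite -subr_eq0; apply/eqP/sep => [|i si].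
      by rewrite rpredB // big_seq rpred_sum // => j sj; rewrite rpredZ // fU.
    by rewrite linearB /= dual_sum // subrr.
  by rewrite big_seq rpred_sum // => j sj; rewrite rpredZ // memv_span // map_f.
(* g i vanishes on the span of the other vectors but not at f i *)
elim: s s_uniq dual {fU sep dual_sum} => [|i s IHs] /=.
  by rewrite nil_free.
case/andP=> s'i s_uniq dual; rewrite free_cons IHs //; last first.
  by move=> j k sj sk; apply: dual; rewrite inE (sj, sk) orbT.
rewrite andbT; apply/negP=> fi_span.
pose gi := linfun (g i : V -> K^o).
have /subvP/(_ _ fi_span): (<<[seq f j | j <- s]>> <= lker gi)%VS.
  apply/span_subvP=> _ /mapP[j sj ->]; rewrite memv_ker lfunE /=.
  rewrite dual ?inE ?eqxx ?sj ?orbT //.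
  by case: (i =P j) => // ij; rewrite ij sj in s'i.
by rewrite memv_ker lfunE /= dual ?inE ?eqxx // oner_eq0.
Qed.

(** * Coordinates in the basis x_1, ..., x_n *)

(** The index k counts from 1, as for x_. *)
Definition coef (K : fieldType) n (k : nat) (v : 'rV[K]_n.+1) : K :=
  v 0 (inord k.-1).

Fact coef_linear (K : fieldType) n k : scalar (@coef K n k).
Proof. by move=> a u v; rewrite /coef !mxE. Qed.
HB.instance Definition _ (K : fieldType) n k :=
  GRing.isLinear.Build K 'rV[K]_n.+1 K _ (@coef K n k) (@coef_linear K n k).

Lemma coef_x (K : fieldType) n k j : (1 <= k <= n.+1)%N ->
  coef k (x_ K n.+1 j) = (j == k)%:R.
Proof.
case: k => // k kn; rewrite /coef mxE inordK //.
by rewrite eq_sym.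
Qed.

(** The index (a, b, k) names the structure constant of x_k in
    phi(x_a, x_b). *)
Definition pivot (K : fieldType) n (p : nat * nat * nat)
    (phi : 'Hom('rV[K]_n.+1, 'Hom('rV[K]_n.+1, 'rV[K]_n.+1))) : K :=
  coef p.2 (phi (x_ K n.+1 p.1.1) (x_ K n.+1 p.1.2)).

Fact pivot_linear (K : fieldType) n p : scalar (@pivot K n p).
Proof. by move=> a u v; rewrite /pivot !(add_lfunE, scale_lfunE) linearP. Qed.
HB.instance Definition _ (K : fieldType) n p :=
  GRing.isLinear.Build K _ K _ (@pivot K n p) (@pivot_linear K n p).

Lemma row_sum_x (K : fieldType) n (u : 'rV[K]_n) :
  u = \sum_(i < n) u 0 i *: x_ K n i.+1.
Proof.
apply/rowP=> j; rewrite summxE (bigD1 j) //= !mxE eqxx mulr1 big1 ?addr0 //.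
by move=> i /negPf ij; rewrite !mxE eqSS eq_sym (inj_eq val_inj) ij mulr0.
Qed.

Lemma lfun_x_ext (K : fieldType) n (V : vectType K) (f g : 'Hom('rV[K]_n, V)) :
  (forall i, (1 <= i <= n)%N -> f (x_ K n i) = g (x_ K n i)) -> f = g.
Proof.
move=> fg; apply/lfunP=> u; rewrite [u]row_sum_x !linear_sum.
by apply: eq_bigr => i _; rewrite !linearZ; congr (_ *: _); apply: fg => /=.
Qed.

Lemma coef_ext (K : fieldType) n (u : 'rV[K]_n.+1) :
  (forall k, (1 <= k <= n.+1)%N -> coef k u = 0) -> u = 0.
Proof.
move=> u0; apply/rowP=> i; rewrite mxE -(u0 i.+1) //=.
by rewrite /coef /= inord_val.
Qed.

Lemma x_0 (K : fieldType) n : x_ K n 0 = 0.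
Proof. by apply/rowP=> i; rewrite !mxE. Qed.

(** Admitting the index 0, where x_ vanishes, lets shift a = 0 stand for
    r x_a = 0, so that products need no case distinction. *)
Lemma bilin_of_x (K : fieldType) n (f : nat -> nat -> 'rV[K]_n) a b :
  (forall i, f 0%N i = 0) -> (forall i, f i 0%N = 0) ->
  (a <= n)%N -> (b <= n)%N ->
  bilin_of f (x_ K n a) (x_ K n b) = f a b.
Proof.
move=> f0l f0r an bn.
case: a b an bn => [|a] [|b] an bn; last exact: bilin_of_basis.
- by rewrite x_0 linear0 f0l.
- by rewrite x_0 linear0 zero_lfunE f0l.
by rewrite x_0 linear0 f0r.
Qed.

(** * The cocycle equation in the filiform algebra *)

(** The action of right multiplication by x_1 on indices: r x_a = x_(shift a),
    with value 0 exactly where r x_a = 0. *)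
Definition shift n a := if (1 <= a <= n - 2)%N then a.+1 else 0%N.

Lemma F2_mul_x (K : fieldType) n a b : (a <= n)%N -> (b <= n)%N ->
  F2_mul K n (x_ K n a) (x_ K n b) = (b == 1%N)%:R *: x_ K n (shift n a).
Proof.
move=> an bn; rewrite bilin_of_x //; last by move=> i; rewrite andbF.
rewrite /shift; case: eqP => _; rewrite ?(andbT, andbF, scale1r, scale0r) //.
by case: ifP; rewrite ?x_0.
Qed.

Lemma F2_mulE (K : fieldType) n u v :
  F2_mul K n.+1 u v = coef 1 v *: F2_mul K n.+1 u (x_ K n.+1 1).
Proof.
rewrite {1}[v]row_sum_x linear_sum big_ord_recl /= big1 ?addr0 => [|i _].
  by rewrite linearZ /coef /= (inord_val ord0).
rewrite linearZ [u]row_sum_x linear_sum /= sum_lfunE big1 ?scaler0 // => j _.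
rewrite linearZ /= scale_lfunE F2_mul_x ?[(_ < _)%N]ltn_ord //.
by rewrite scale0r scaler0.
Qed.

Lemma ZL2_basisP (K : fieldType) n (br : leibniz_bracket 'rV[K]_n) phi :
  reflect (forall a b c, (1 <= a <= n)%N -> (1 <= b <= n)%N ->
             (1 <= c <= n)%N ->
             cocycle_expr br phi (x_ K n a) (x_ K n b) (x_ K n c) = 0)
          (phi \in ZL2 br).
Proof.
apply: (iffP idP) => [/ZL2P Z a b c _ _ _|Z]; first exact: Z.
rewrite memv_ker lfunE; apply/eqP.
apply: lfun_x_ext => a ha; apply: lfun_x_ext => b hb; apply: lfun_x_ext => c hc.
by rewrite differentialE Z // !zero_lfunE.
Qed.

(** The three conditions are the cocycle equation at (x_a, x_b, x_c) for
    b, c >= 2, for b = 1 < c, and for c = 1. In the last case, when b >= 2, the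
    commutator of r and phi(-, x_b) has been eliminated by means of the second
    condition; when b = 1 it cancels by itself, which is why the correction
    term is absent. *)
Lemma ZL2_F2P (K : fieldType) m (n := m.+3)
    (phi : 'Hom('rV[K]_n, 'Hom('rV[K]_n, 'rV[K]_n))) :
  let x := x_ K n in
  let r u := F2_mul K n u (x 1%N) in
  reflect
    [/\ forall b c, (1 < b <= n)%N -> (1 < c <= n)%N ->
          coef 1 (phi (x b) (x c)) = 0,
        forall a c, (1 <= a <= n)%N -> (1 < c <= n)%N ->
          r (phi (x a) (x c)) - phi (r (x a)) (x c)
          = - coef 1 (phi (x 1%N) (x c)) *: r (x a)
      & forall a b, (1 <= a <= n)%N -> (1 <= b <= n)%N ->
          phi (x a) (r (x b))
          = - (coef 1 (phi (x b) (x 1%N))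
               + (if b == 1%N then 0 else coef 1 (phi (x 1%N) (x b))))
            *: r (x a)]
    (phi \in ZL2 (F2 K n)).
Proof.
move=> x r.
have F2r u v : F2 K n u v = coef 1 v *: r u by apply: F2_mulE.
have cx k : coef 1 (x k) = (k == 1%N)%:R by rewrite coef_x.
have rx a : (a <= n)%N -> r (x a) = x (shift n a).
  by move=> an; rewrite /r /x F2_mul_x // scale1r.
have E a b c : (a <= n)%N -> (b <= n)%N -> (c <= n)%N ->
    cocycle_expr (F2 K n) phi (x a) (x b) (x c) =
      coef 1 (phi (x b) (x c)) *: r (x a)
      - (c == 1%N)%:R *: r (phi (x a) (x b))
      + (b == 1%N)%:R *: r (phi (x a) (x c))
      + (c == 1%N)%:R *: phi (x a) (r (x b))
      - (b == 1%N)%:R *: phi (r (x a)) (x c)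
      + (c == 1%N)%:R *: phi (r (x a)) (x b).
  move=> an bn cn.
  by rewrite /cocycle_expr !F2r !cx !linearZ /= !scale_lfunE !scalerN.
apply: (iffP (ZL2_basisP _ _)) => [Z | [ZA ZB ZC] a b c].
  have n1 : (1 <= 1 <= n)%N by [].
  have ZB a c : (1 <= a <= n)%N -> (1 < c <= n)%N ->
      r (phi (x a) (x c)) - phi (r (x a)) (x c)
      = - coef 1 (phi (x 1%N) (x c)) *: r (x a).
    move=> ha hc; have := Z a 1%N c ha n1; rewrite E; try lia.
    have -> : (c == 1%N) = false by lia.
    rewrite eqxx !scale0r !scale1r subr0 !addr0 => Z1.
    by apply/eqP; rewrite scaleNr -subr_eq0 opprK addrC addrA Z1 //; lia.
  split=> // [b c hb hc|a b ha hb].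
    (* r x_1 = x_2 is nonzero because n >= 3 *)
    have := Z 1%N b c n1; rewrite E; try lia.
    have -> : (c == 1%N) = false by lia.
    have -> : (b == 1%N) = false by lia.
    rewrite !scale0r !(addr0, subr0) => Z1.
    have /(congr1 (coef 2)) := Z1 ltac:(lia) ltac:(lia).
    by rewrite linearZ rx //= coef_x //= mulr1 linear0.
  have := Z a b 1%N ha hb n1; rewrite E; try lia.
  case: (b =P 1%N) => [-> | b1]; rewrite eqxx ?scale0r ?scale1r.
    by rewrite addr0 !subrK scaleNr => /addr0_eq ->.
  have hb1 : (1 < b <= n)%N by lia.
  rewrite addr0 subr0 scaleNr scalerDl opprD.
  rewrite -(scaleNr (coef 1 (phi (x 1%N) _))) -ZB // => Z1.
  apply/eqP; rewrite -subr_eq0 -[X in _ == X]Z1 opprD opprK opprB.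
  by rewrite [X in X == _](AC (1*(1*2)) (2*4*1*3)).
move=> ha hb hc; rewrite E; try lia.
case: (c =P 1%N) => [-> | c1]; case: (b =P 1%N) => [-> | b1];
  rewrite ?(scale0r, scale1r, addr0, subr0).
- by rewrite !subrK ZC // addr0 scaleNr subrr.
- have hb1 : (1 < b <= n)%N by lia.
  rewrite ZC // (introF eqP b1) scaleNr scalerDl opprD.
  rewrite -(scaleNr (coef 1 (phi (x 1%N) _))) -ZB //.
  by rewrite [LHS](AC (2*(1*2)*1) ((1*3)*(2*4)*(5*6))) /= subrr !addNr !addr0.
- have hc1 : (1 < c <= n)%N by lia.
  by rewrite -addrA ZB // scaleNr subrr.
by rewrite ZA ?scale0r //; lia.
Qed.

(** * The pivots of the family *)

(** Listed in the order of the cochains of the family that they select: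
    phi_(j,1), phi_(j,k), psi_1, psi_j, psi_n, psi_(n+1), psi_(n+2). *)
Definition pivots n : seq (nat * nat * nat) :=
  [seq (j, 1, 1)%N | j <- iota 1 (n - 2)]
  ++ [seq (j, 1, k)%N | j <- iota 1 n, k <- iota 2 (n - 1)]
  ++ [:: (n, 1, 1)%N]
  ++ [seq (1, n, j)%N | j <- iota 2 (n - 2)]
  ++ [:: (1, n, n)%N; (n, n, n - 1)%N; (n, n, n)%N].

Definition pivot_cochain (K : fieldType) n (p : nat * nat * nat) :
    'Hom('rV[K]_n, 'Hom('rV[K]_n, 'rV[K]_n)) :=
  let: (a, b, k) := p in
  if (b == 1)%N then
    if (k == 1)%N then
      if (a == n)%N then cochain_psi1 K n else cochain_phi1 K n a
    else cochain_phi K n a k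
  else if (a == 1)%N then
    if (k == n)%N then cochain_psin K n else cochain_psi K n k
  else if (k == n)%N then cochain_psin2 K n else cochain_psin1 K n.

Lemma ZL2_familyE (K : fieldType) n : (2 < n)%N ->
  ZL2_family K n = [seq pivot_cochain K n p | p <- pivots n].
Proof.
move=> hn; have n_1 : (n == 1)%N = false by lia.
rewrite /ZL2_family /pivots !map_cat; congr (_ ++ _).
  rewrite -map_comp; apply/eq_in_map => j; rewrite mem_iota /= => hj.
  by have -> : (j == n) = false by lia.
congr (_ ++ _).
  rewrite map_allpairs; apply/eq_in_allpairs => j k _; rewrite mem_iota /=.
  by case: k => [|[]].
congr (_ ++ _); first by rewrite /= eqxx.
congr (_ ++ _).
  rewrite -map_comp; apply/eq_in_map => j; rewrite mem_iota /= n_1 => hj.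
  by have -> : (j == n) = false by lia.
have n1n : (n - 1 == n)%N = false by lia.
by rewrite /= !eqxx n1n n_1.
Qed.

Lemma mem_pivots_phi1 n a b k :
  ((a, b, k) \in [seq (j, 1, 1)%N | j <- iota 1 (n - 2)])
  = [&& b == 1, k == 1 & 1 <= a <= n - 2]%N.
Proof.
apply/mapP/idP => [[j]|]; first by rewrite mem_iota => ? [-> -> ->]; lia.
by case/and3P=> /eqP-> /eqP-> ha; exists a; rewrite ?mem_iota //; lia.
Qed.

Lemma mem_pivots_phi n a b k :
  ((a, b, k) \in [seq (j, 1, k)%N | j <- iota 1 n, k <- iota 2 (n - 1)])
  = [&& b == 1, 1 <= a <= n & 2 <= k <= n]%N.
Proof.
apply/allpairsP/idP => [[[j i] /=]|].
  by rewrite !mem_iota => -[? ? [-> -> ->]]; lia.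
case/and3P=> /eqP-> ha hk; exists (a, k); rewrite /= !mem_iota.
by split=> //; lia.
Qed.

Lemma mem_pivots_psi n a b k :
  ((a, b, k) \in [seq (1, n, j)%N | j <- iota 2 (n - 2)])
  = [&& a == 1, b == n & 2 <= k <= n - 1]%N.
Proof.
apply/mapP/idP => [[j]|]; first by rewrite mem_iota => ? [-> -> ->]; lia.
by case/and3P=> /eqP-> /eqP-> ha; exists k; rewrite ?mem_iota //; lia.
Qed.

(** Seen by position: column 1 carries all coefficients but that of x_1 in
    phi(x_(n-1), x_1), which cocycles do not have. *)
Lemma mem_pivots n a b k : (2 < n)%N ->
  ((a, b, k) \in pivots n) =
  [|| [&& b == 1, 1 <= a <= n & 2 <= k <= n],
      [&& b == 1, k == 1, 1 <= a <= n & a != n - 1],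
      [&& a == 1, b == n & 2 <= k <= n]
    | [&& a == n, b == n & n - 1 <= k <= n]]%N.
Proof.
move=> hn; rewrite !mem_cat mem_pivots_phi1 mem_pivots_phi mem_pivots_psi.
rewrite !inE !xpair_eqE.
have [-> | b1] := eqVneq b 1%N.
  have -> : (1 == n)%N = false by lia.
  rewrite !(andbF, andFb, orbF, andTb).
  by apply/idP/idP; lia.
have [_ | _] := eqVneq b n; rewrite !(andbF, andFb, orFb, andTb) //.
by apply/idP/idP; lia.
Qed.

Lemma pivots_uniq n : (2 < n)%N -> uniq (pivots n).
Proof.
move=> hn.
rewrite /pivots !cat_uniq map_inj_uniq ?iota_uniq //; last by move=> i j [].
rewrite map_inj_uniq ?iota_uniq //; last by move=> i j [].
rewrite allpairs_uniq ?iota_uniq //; last by move=> [i j] [k l] _ _ [-> ->].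
rewrite !andTb; apply/and5P; split => //.
- apply/hasPn => -[[a b] k]; rewrite mem_pivots_phi1.
  rewrite !mem_cat mem_pivots_phi mem_pivots_psi !inE !xpair_eqE; lia.
- apply/hasPn => -[[a b] k]; rewrite mem_pivots_phi.
  rewrite !mem_cat mem_pivots_psi !inE !xpair_eqE; lia.
- apply/hasPn => -[[a b] k]; rewrite inE.
  rewrite !mem_cat mem_pivots_psi !inE !xpair_eqE; lia.
- apply/hasPn => -[[a b] k]; rewrite mem_pivots_psi !inE !xpair_eqE; lia.
by rewrite /= !inE !xpair_eqE; lia.
Qed.

(** Pivots only involve the columns b = 1 and b = n. In column 1 every cochain
    of the family has at most the one entry of its pivot: the remaining entries
    of phi_(j,1) lie in column j+1, with 1 < j+1 < n, and those of psi_1 in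
    column n. *)
Lemma pivot_cochain_col1 (K : fieldType) n a b k c : (2 < n)%N ->
  (a, b, k) \in pivots n -> (1 <= c <= n)%N ->
  pivot_cochain K n (a, b, k) (x_ K n c) (x_ K n 1)
  = ((c == a) && (b == 1))%N%:R *: x_ K n k.
Proof.
move=> hn; rewrite mem_pivots // => hp hc; have n1 : (1 <= 1 <= n)%N by lia.
have n_1 : (1 == n)%N = false by lia.
have [-> | b1] := eqVneq b 1%N; rewrite /pivot_cochain /= ?andbF ?andbT.
  case: eqP => [k1 | /eqP k1]; last first.
    rewrite bilin_of_basis // eqxx andbT.
    by case: eqP => _; rewrite ?scale1r ?scale0r.
  case: eqP => [-> | /eqP an]; rewrite bilin_of_basis // ?eqxx k1.
    by rewrite n_1 andbF andbT; case: eqP => _; rewrite ?scale1r ?scale0r.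
  have -> : (1 == a.+1)%N = false by lia.
  by rewrite andbF andbT; case: eqP => _; rewrite ?scale1r ?scale0r.
rewrite (negPf b1) scale0r.
by case: ifP => _; case: ifP => _; rewrite bilin_of_basis // n_1 andbF.
Qed.

(** The pivots in column n have c = 1 < l or c = n, so they miss the diagonal
    entries of psi_1 and all entries of psi_j but the one at x_1. *)
Lemma pivot_cochain_coln (K : fieldType) n a b k c l : (2 < n.+1)%N ->
  (a, b, k) \in pivots n.+1 -> (c, n.+1, l) \in pivots n.+1 ->
  coef l (pivot_cochain K n.+1 (a, b, k) (x_ K n.+1 c) (x_ K n.+1 n.+1))
  = ((c, n.+1, l) == (a, b, k))%:R.
Proof.
set N := n.+1 => hN; rewrite !mem_pivots // !xpair_eqE => hp hc.
have N_1 : (N == 1)%N = false by lia.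
have hNN : (1 <= N <= N)%N by lia.
rewrite N_1 /= in hc; have hl : (1 <= l <= N)%N by lia.
have hc1 : (1 <= c <= N)%N by lia.
have [b1 | /negPf b1] := eqVneq b 1%N;
  rewrite /pivot_cochain /= b1 ?eqxx ?N_1 ?andbF.
  have cN : (c == 1%N) || (c == N) by lia.
  case: eqP => [k1 | /eqP k1]; last first.
    by rewrite bilin_of_basis // N_1 andbF linear0.
  case: eqP => [_ | /eqP aN]; rewrite bilin_of_basis // N_1 andbF.
    rewrite eqxx andbT; case: ifP => cN1; last by rewrite linear0.
    have cl : (c == l) = false by lia.
    by rewrite linearN linearZ /= coef_x // cl mulr0 oppr0.
  have -> : (N == a.+1) = false by lia.
  by rewrite andbF linear0.
have bN : b = N by lia.
rewrite bN eqxx /=.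
have [a1 | a1] := eqVneq a 1%N.
  have [kN | kN] := eqVneq k N; rewrite bilin_of_basis // eqxx andbT.
    case: ifP => [/eqP -> | ca]; rewrite ?linear0 ?coef_x // a1 ?eqxx ?ca // kN.
    by rewrite eq_sym.
  case: ifP => cs; [rewrite coef_x // | rewrite linear0 -[LHS](mulr0n 1)];
    by congr (_%:R); lia.
have aN : a = N by lia.
have [kN | kN] := eqVneq k N; rewrite bilin_of_basis // eqxx andbT.
  by case: ifP => cN; rewrite ?linear0 ?coef_x // aN kN cN // eq_sym.
case: ifP => cN; [rewrite coef_x // | rewrite linear0 -[LHS](mulr0n 1)];
  by congr (_%:R); lia.
Qed.

Lemma pivot_dual (K : fieldType) n : (2 < n.+1)%N ->
  {in pivots n.+1 &, forall p q,
    pivot p (pivot_cochain K n.+1 q) = (p == q)%:R}.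
Proof.
move=> hn [[c d] l] [[a b] k] hp hq.
have := hp; rewrite mem_pivots // => hp'.
have [d1 | d1] := eqVneq d 1%N; last first.
  have dn : d = n.+1 by lia.
  by rewrite dn in hp *; apply: pivot_cochain_coln.
have hc : (1 <= c <= n.+1)%N by lia.
have hl : (1 <= l <= n.+1)%N by lia.
rewrite /pivot d1 pivot_cochain_col1 // linearZ /= coef_x //.
rewrite -natrM mulnb !xpair_eqE (eq_sym 1%N b) (eq_sym l) -?andbA.
by congr (_%:R).
Qed.

(** * Cocycles with vanishing pivots *)

(** Consequently an element of the kernel of r only involves x_(n-1) and
    x_n. *)
Lemma coef_F2_mul (K : fieldType) n k u : (1 <= k <= n.+1 - 2)%N ->
  coef k.+1 (F2_mul K n.+1 u (x_ K n.+1 1)) = coef k u.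
Proof.
move=> hk; rewrite [u]row_sum_x !linear_sum sum_lfunE linear_sum.
apply: eq_bigr => i _; rewrite !linearZ scale_lfunE !linearZ; congr (_ * _).
have hi := ltn_ord i.
have hk1 : (1 <= k <= n.+1)%N by lia.
rewrite /= F2_mul_x // scale1r !coef_x //; last by lia.
congr (_%:R); rewrite /shift; case: ifP; lia.
Qed.

(** The columns vanish in the order 2, ..., n-1, then 1, then n. Vanishing of
    the coefficients a_b kills the middle columns one after the other. The two
    ends of the shift then supply the coefficients missing from the pivots:
    a_(n-1), and the x_1 component of phi(x_1, x_n). Finally the last column
    commutes with r, so it is determined by its value at x_1 and by its value
    at x_n, which lies in the kernel of r. *)
Lemma ZL2_F2_pivots_eq0 (K : fieldType) m (n := m.+3) phi :
  phi \in ZL2 (F2 K n) -> {in pivots n, forall p, pivot p phi = 0} -> phi = 0.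
Proof.
have hn : (2 < n)%N by [].
move=> /ZL2_F2P[]; rewrite -/n; set x := x_ K n => ZA ZB ZC P0.
have P a b k : (a, b, k) \in pivots n -> coef k (phi (x a) (x b)) = 0.
  by move=> /P0.
have rx a : (a <= n)%N -> F2_mul K n (x a) (x 1%N) = x (shift n a).
  by move=> an; rewrite F2_mul_x // scale1r.
have x0 : x 0%N = 0 by apply: x_0.
have x2_eq0 c : 0 = - c *: x 2%N -> c = 0.
  move=> /(congr1 (coef 2)); rewrite linear0 linearZ /= coef_x //= mulr1.
  by move=> /esym/eqP; rewrite oppr_eq0 => /eqP.
have T0 a : (1 <= a <= n)%N -> a != n.-1 -> coef 1 (phi (x a) (x 1%N)) = 0.
  by move=> ha an; apply: P; rewrite mem_pivots //; lia.
have col_mid b a : (1 < b <= n.-1)%N -> (1 <= a <= n)%N -> phi (x a) (x b) = 0.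
  elim: b a => // b IHb a hb ha.
  have hb1 : (1 <= b <= n)%N by lia.
  have := ZC a b ha hb1; rewrite rx; last by lia.
  have -> : shift n b = b.+1 by rewrite /shift ifT //; lia.
  move=> ->; rewrite T0 //; last by lia.
  case: ifP => b1; first by rewrite addr0 oppr0 scale0r.
  by rewrite IHb ?linear0 ?addr0 ?oppr0 ?scale0r //; lia.
have last0 b : (n.-1 <= b <= n)%N ->
    coef 1 (phi (x b) (x 1%N)) + coef 1 (phi (x 1%N) (x b)) = 0.
  move=> hb; have hb1 : (1 <= b <= n)%N by lia.
  (* shift b = 0, so the left-hand side of the third condition vanishes, while
     r x_1 = x_2 does not *)
  have := ZC 1%N b isT hb1; rewrite !rx; try lia.
  have -> : shift n b = 0%N by rewrite /shift ifF //; lia.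
  have -> : (b == 1%N) = false by lia.
  by rewrite x0 linear0 => Z; apply: x2_eq0; rewrite Z.
have Tn1 : coef 1 (phi (x n.-1) (x 1%N)) = 0.
  have := last0 n.-1 ltac:(lia); rewrite (col_mid n.-1); try lia.
  by rewrite linear0 addr0.
have Mn : coef 1 (phi (x 1%N) (x n)) = 0.
  have := last0 n ltac:(lia); rewrite T0; try lia.
  by rewrite add0r.
have col_1 a : (1 <= a <= n)%N -> phi (x a) (x 1%N) = 0.
  move=> ha; apply: coef_ext => k hk.
  have [-> | k1] := eqVneq k 1%N.
    by have [-> // | an] := eqVneq a n.-1; apply: T0.
  by apply: P; rewrite mem_pivots //; lia.
have shift_n a : (1 <= a <= n)%N ->
    phi (x (shift n a)) (x n) = F2_mul K n (phi (x a) (x n)) (x 1%N).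
  move=> ha; have := ZB a n ha ltac:(lia).
  rewrite Mn oppr0 scale0r -rx; last by lia.
  by move=> /eqP; rewrite subr_eq0 => /eqP.
have col_n a : (1 <= a <= n.-1)%N -> phi (x a) (x n) = 0.
  elim: a => // a IHa ha; have [-> | a0] := eqVneq a 0%N.
    apply: coef_ext => k hk; have [-> // | k1] := eqVneq k 1%N.
    by apply: P; rewrite mem_pivots //; lia.
  have <- : shift n a = a.+1 by rewrite /shift ifT //; lia.
  by rewrite shift_n ?IHa ?linear0 ?zero_lfunE //; lia.
have col_nn : phi (x n) (x n) = 0.
  apply: coef_ext => k hk.
  have [-> | k1] := eqVneq k 1%N; first by apply: ZA; lia.
  have [kn | kn] := leqP k (n - 2); last first.
    by apply: P; rewrite mem_pivots //; lia.
  rewrite -coef_F2_mul; last by lia.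
  rewrite -shift_n; last by rewrite leqnn.
  by rewrite /shift ifF ?x0 ?linear0 ?zero_lfunE ?linear0 //; lia.
apply: lfun_x_ext => a ha; apply: lfun_x_ext => b hb; rewrite !zero_lfunE -/x.
have [-> | b1] := eqVneq b 1%N; first exact: col_1.
have [-> | bn] := eqVneq b n; last by apply: col_mid => //; lia.
by have [-> // | an] := eqVneq a n; apply: col_n; lia.
Qed.

(** * The family consists of cocycles *)

(** The criterion ZL2_F2P read off the structure constants. *)
Lemma bilin_of_ZL2_F2 (K : fieldType) m (n := m.+3) (x := x_ K n)
    (f : nat -> nat -> 'rV[K]_n) :
  (forall i, f 0%N i = 0) -> (forall i, f i 0%N = 0) ->
  (forall b c, (1 < b <= n)%N -> (1 < c <= n)%N -> coef 1 (f b c) = 0) ->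
  (forall a c, (1 <= a <= n)%N -> (1 < c <= n)%N ->
     F2_mul K n (f a c) (x 1%N)
     = f (shift n a) c - coef 1 (f 1%N c) *: x (shift n a)) ->
  (forall a b, (1 <= a <= n)%N -> (1 <= b <= n)%N ->
     f a (shift n b)
     = - (coef 1 (f b 1%N) + (if b == 1%N then 0 else coef 1 (f 1%N b)))
       *: x (shift n a)) ->
  bilin_of f \in ZL2 (F2 K n).
Proof.
move=> f0l f0r fA fB fC.
have next_le a : (shift n a <= n)%N by rewrite /shift; case: ifP => //; lia.
have fE a b : (a <= n)%N -> (b <= n)%N -> bilin_of f (x a) (x b) = f a b.
  exact: bilin_of_x.
have rx a : (a <= n)%N -> F2_mul K n (x a) (x 1%N) = x (shift n a).
  by move=> an; rewrite F2_mul_x // scale1r.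
apply/ZL2_F2P; rewrite -/n -/x; split=> [b c hb hc | a c ha hc | a b ha hb].
- by rewrite fE ?fA //; lia.
- have [an cn] : (a <= n)%N /\ (c <= n)%N by lia.
  by rewrite rx // !fE // fB // scaleNr addrC addKr.
have [an bn] : (a <= n)%N /\ (b <= n)%N by lia.
by rewrite !rx // !fE // fC.
Qed.

Lemma cochain_phi_ZL2 (K : fieldType) m (n := m.+3) j k :
  (1 <= j)%N -> (2 <= k <= n)%N -> cochain_phi K n j k \in ZL2 (F2 K n).
Proof.
move=> j0 hk.
have j0F : (0%N == j) = false by lia.
have k1F : (k == 1%N) = false by lia.
apply: bilin_of_ZL2_F2 => [i | i | b c hb hc | a c ha hc | a b ha hb].
- by rewrite j0F.
- by rewrite andbF.
- have -> : (c == 1%N) = false by lia.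
  by rewrite andbF linear0.
- have -> : (c == 1%N) = false by lia.
  by rewrite !andbF !linear0 zero_lfunE scale0r subr0.
have -> : (shift n b == 1%N) = false by rewrite /shift; case: ifP; lia.
rewrite andbF andbT [coef 1 (if _ then _ else _)](_ : _ = 0); last first.
  by case: ifP; rewrite ?linear0 ?coef_x // k1F.
have [_ | _] := eqVneq b 1%N; rewrite ?andbF ?linear0 addr0 oppr0 scale0r //.
Qed.

(** Away from column 1 this cochain is - r in column j+1, which is what the
    third condition asks for when a_b = (b == j). *)
Lemma cochain_phi1_ZL2 (K : fieldType) m (n := m.+3) j :
  (1 <= j <= n - 2)%N -> cochain_phi1 K n j \in ZL2 (F2 K n).
Proof.
move=> hj; have x0 : x_ K n 0 = 0 by apply: x_0.
have j0F : (0%N == j) = false by lia.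
have fNx a c : (c != 1%N) ->
   (if (a == j) && (c == 1%N) then x_ K n 1
    else if (1 <= a <= n - 2)%N && (c == j.+1) then - x_ K n a.+1 else 0)
   = - ((c == j.+1)%:R *: x_ K n (shift n a)).
  move=> /negPf->; rewrite andbF /shift.
  case: eqP => _; rewrite ?(andbT, andbF, scale1r, scale0r, oppr0) //.
  by case: ifP; rewrite ?x0 ?oppr0.
have coef_shift a : coef 1 (x_ K n (shift n a)) = 0.
  by rewrite coef_x // /shift; case: ifP => //; case: a.
apply: bilin_of_ZL2_F2 => [i | i | b c hb hc | a c ha hc | a b ha hb].
- by rewrite j0F.
- by rewrite andbF andbF.
- rewrite fNx; last by lia.
  by rewrite linearN linearZ /= coef_shift mulr0 oppr0.
- have c1 : c != 1%N by lia.
  rewrite !fNx // !linearN !linearZ /= scale_lfunE opp_lfunE.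
  have na : (shift n a <= n)%N by rewrite /shift; case: ifP; lia.
  by rewrite F2_mul_x // scale1r coef_shift mulr0 oppr0 scale0r addr0.
rewrite fNx; last by rewrite /shift; case: ifP; lia.
have -> : (if b == 1%N then 0 else
    coef 1 (if (1%N == j) && (b == 1%N) then x_ K n 1
    else if (1 <= 1 <= n - 2)%N && (b == j.+1) then - x_ K n 2 else 0)) = 0.
  move: (fNx 1%N b); case: (b == 1%N) => // /(_ isT) ->.
  by rewrite linearN linearZ /= coef_shift mulr0 oppr0.
have -> : (1%N == j.+1) = false by lia.
rewrite !andbF andbT addr0 -scaleNr; congr (- _ *: _).
have -> : (shift n b == j.+1) = (b == j) by rewrite /shift; case: ifP; lia.
by case: eqP; rewrite ?linear0 ?coef_x.
Qed.

(** A cochain supported on column n, where it is a map without x_1 component,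
    is a cocycle as soon as this map commutes with r. The cochains psi_j with
    j >= 2 are of this kind, and their last columns send basis vectors to basis
    vectors or to zero, so commutation is a statement on indices. *)
Lemma last_column_ZL2 (K : fieldType) m (n := m.+3) (s : nat -> nat)
   (f : nat -> nat -> 'rV[K]_n) :
  (forall a b, f a b = if b == n then x_ K n (s a) else 0) ->
  s 0%N = 0%N -> (forall a, (1 <= a <= n)%N -> (s a <= n)%N /\ s a != 1%N) ->
  (forall a, (1 <= a <= n)%N -> s (shift n a) = shift n (s a)) ->
  bilin_of f \in ZL2 (F2 K n).
Proof.
move=> fE s0 sn sC; have x0 : x_ K n 0 = 0 by apply: x_0.
have coef_f a b : (1 <= a <= n)%N -> coef 1 (f a b) = 0.
  move=> /sn[_ /negPf san]; rewrite fE; case: ifP => _; rewrite ?linear0 //.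
  by rewrite coef_x // san.
apply: bilin_of_ZL2_F2 => [i | i | b c hb hc | a c ha hc | a b ha hb].
- by rewrite fE s0 x0 if_same.
- by rewrite fE.
- by apply: coef_f; lia.
- rewrite coef_f // scale0r subr0 !fE; case: ifP => _.
    by have [san _] := sn a ha; rewrite F2_mul_x // scale1r sC.
  by rewrite linear0 zero_lfunE.
rewrite !coef_f // if_same addr0 oppr0 scale0r fE ifF //.
by rewrite /shift; case: ifP; lia.
Qed.

Lemma cochain_psi_ZL2 (K : fieldType) m (n := m.+3) j :
  (2 <= j <= n - 1)%N -> cochain_psi K n j \in ZL2 (F2 K n).
Proof.
move=> hj.
apply: (@last_column_ZL2 K m
  (fun a => if (1 <= a <= n - j)%N then j + a - 1 else 0)%N) => //=.
- by move=> a b; rewrite andbC; case: eqP => //= _; case: ifP; rewrite ?x_0.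
- by move=> a ha; case: ifP; lia.
- by move=> a ha; rewrite /shift; repeat case: ifP; lia.
Qed.

Lemma cochain_psin_ZL2 (K : fieldType) m (n := m.+3) :
  cochain_psin K n \in ZL2 (F2 K n).
Proof.
apply: (@last_column_ZL2 K m (fun a => if a == 1 then n else 0)%N) => //=.
- by move=> a b; rewrite andbC; case: eqP => //= _; case: ifP; rewrite ?x_0.
- by move=> a ha; case: ifP; lia.
- by move=> a ha; rewrite /shift; repeat case: ifP; lia.
Qed.

Lemma cochain_psin1_ZL2 (K : fieldType) m (n := m.+3) :
  cochain_psin1 K n \in ZL2 (F2 K n).
Proof.
apply: (@last_column_ZL2 K m (fun a => if a == n then n - 1 else 0)%N) => //=.
- by move=> a b; rewrite andbC; case: eqP => //= _; case: ifP; rewrite ?x_0.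
- by move=> a ha; case: ifP; lia.
- by move=> a ha; rewrite /shift; repeat case: ifP; lia.
Qed.

Lemma cochain_psin2_ZL2 (K : fieldType) m (n := m.+3) :
  cochain_psin2 K n \in ZL2 (F2 K n).
Proof.
apply: (@last_column_ZL2 K m (fun a => if a == n then n else 0)%N) => //=.
- by move=> a b; rewrite andbC; case: eqP => //= _; case: ifP; rewrite ?x_0.
- by move=> a ha; case: ifP; lia.
- by move=> a ha; rewrite /shift; repeat case: ifP; lia.
Qed.

(** The last column d : x_a -> - a x_a satisfies r d - d r = r, which balances
    the second condition since coef 1 (d x_1) = -1; in the third condition the
    same -1 cancels the x_1 component of psi_1(x_n, x_1). *)
Lemma cochain_psi1_ZL2 (K : fieldType) m (n := m.+3) :
  cochain_psi1 K n \in ZL2 (F2 K n).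
Proof.
have x0 : x_ K n 0 = 0 by apply: x_0.
pose d a : 'rV[K]_n := if (1 <= a <= n - 1)%N then - (a%:R *: x_ K n a) else 0.
pose f a c := if (a == n)%N && (c == 1%N) then x_ K n 1
  else if (1 <= a <= n - 1)%N && (c == n)%N then - (a%:R *: x_ K n a) else 0.
have fE a c : (c != 1%N) -> f a c = (c == n)%:R *: d a.
  rewrite /f => /negPf->; rewrite andbF /d.
  by case: eqP => _; rewrite ?andbT ?andbF ?scale1r ?scale0r.
have dE a : (1 <= a <= n - 1)%N -> d a = - (a%:R *: x_ K n a).
  by rewrite /d => ->.
have d1 : coef 1 (d 1%N) = -1.
  by rewrite dE // linearN linearZ /= coef_x //= mulr1.
have coef_d a : (1 < a)%N -> coef 1 (d a) = 0.
  move=> ha; have aF : (a == 1%N) = false by lia.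
  rewrite /d; case: ifP; rewrite ?linear0 // linearN linearZ /= coef_x // aF.
  by rewrite mulr0 oppr0.
have dC a : (1 <= a <= n)%N ->
    F2_mul K n (d a) (x_ K n 1) = d (shift n a) + x_ K n (shift n a).
  move=> ha; rewrite {1}/d; case: ifP => han; last first.
    by rewrite linear0 zero_lfunE /shift ifF ?x0 ?addr0 //; lia.
  rewrite linearN linearZ /= opp_lfunE scale_lfunE F2_mul_x ?scale1r; try lia.
  have [a2 | a2] := leqP a (n - 2); last first.
    by rewrite /shift ifF ?x0 ?scaler0 ?oppr0 ?addr0 //; lia.
  rewrite /shift ifT; last by lia.
  rewrite dE; last by lia.
  by rewrite -[a.+1]addn1 natrD scalerDl scale1r opprD subrK.
have f1 b : f b 1%N = if b == n then x_ K n 1 else 0.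
  have -> : f b 1%N = if (b == n) && true then x_ K n 1
    else if (1 <= b <= n - 1)%N && (1%N == n) then - (b%:R *: x_ K n b)
    else 0 by [].
  by rewrite andbT (_ : (1%N == n) = false) ?andbF //; lia.
have f0l i : f 0%N i = 0 by [].
have f0r i : f i 0%N = 0 by rewrite /f !andbF.
(* d and f enter only through the facts above; hiding their bodies keeps
   simplification from unfolding the entries at index 1 *)
clearbody d; change (bilin_of f \in ZL2 (F2 K n)); clearbody f.
apply: bilin_of_ZL2_F2 => [i | i | b c hb hc | a c ha hc | a b ha hb].
- exact: f0l.
- exact: f0r.
- rewrite fE; last by lia.
  by rewrite linearZ /= coef_d ?mulr0 //; lia.
- have c1 : c != 1%N by lia.
  rewrite !fE // !linearZ /= scale_lfunE dC // d1.
  by rewrite mulrN1 scaleNr scalerN opprK scalerDr.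
rewrite fE; last by rewrite /shift; case: ifP; lia.
have -> : (shift n b == n) = false by rewrite /shift; case: ifP; lia.
rewrite scale0r f1.
have -> : (if b == 1%N then 0 else coef 1 (f 1%N b)) = - (b == n)%:R.
  case: (b =P 1%N) => [-> | /eqP b1]; first by rewrite oppr0.
  by rewrite fE // linearZ /= d1 mulrN1.
case: eqP => _; rewrite ?linear0 ?coef_x //.
  by rewrite subrr oppr0 scale0r.
by rewrite subr0 oppr0 scale0r.
Qed.

Lemma pivot_cochain_ZL2 (K : fieldType) m (n := m.+3) :
  {in pivots n, forall p, pivot_cochain K n p \in ZL2 (F2 K n)}.
Proof.
move=> [[a b] k]; rewrite mem_pivots // => hp; rewrite /pivot_cochain.
case: eqP => b1.
  case: eqP => k1; last by apply: cochain_phi_ZL2; lia.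
  case: eqP => an; first exact: cochain_psi1_ZL2.
  by apply: cochain_phi1_ZL2; lia.
case: eqP => a1; case: eqP => kn.
- exact: cochain_psin_ZL2.
- by apply: cochain_psi_ZL2; lia.
- exact: cochain_psin2_ZL2.
exact: cochain_psin1_ZL2.
Qed.

Lemma ZL2_F2_basis (K : fieldType) n : (2 < n)%N ->
  basis_of (ZL2 (F2 K n)) (ZL2_family K n).
Proof.
move=> hn; rewrite ZL2_familyE //; case: n hn => [|[|[|m]]] // hn.
pose V : vectType K := 'Hom('rV[K]_m.+3, 'Hom('rV[K]_m.+3, 'rV[K]_m.+3)).
pose g (p : nat * nat * nat) : {scalar V} := @pivot K m.+2 p.
pose U : {vspace V} := ZL2 (F2 K m.+3).
pose f : nat * nat * nat -> V := pivot_cochain K m.+3.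
apply: (@basis_of_dual K V _ (pivots m.+3) f g U).
- exact: pivots_uniq.
- exact: pivot_cochain_ZL2.
- exact: pivot_dual.
by move=> phi phiZ; apply: ZL2_F2_pivots_eq0.
Qed.

Theorem theorem3p12 (R : realType) (n : nat) (hn : (3 <= n)%N) :
  basis_of (ZL2 (F2 R[i] n)) (ZL2_family R[i] n).
Proof. exact: ZL2_F2_basis. Qed.
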